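(* Fix a surrogate model $m$, an iteration $t$ and candidates $\lambda,\lambda'\in\Lambda$. Let $q_{m,t}$ be a probability density on $\Theta\subseteq\mathbb{R}^{d_\theta}$, differentiable on its support $\Theta$, with $\int_\Theta\nabla_\theta q_{m,t}(\theta)\,d\theta=0$, and let $g(\theta):=\nabla_\theta\log q_{m,t}(\theta)$. Assume $\mathbb{E}_{q_{m,t}}[\mathrm{EI}_m(\lambda;\theta)^2]<\infty$, $\mathbb{E}_{q_{m,t}}[\mathrm{EI}_m(\lambda';\theta)^2]<\infty$, $\mathbb{E}_{q_{m,t}}[\|g(\theta)\|_2^2]<\infty$, and that $\Sigma_g:=\operatorname{Cov}_{q_{m,t}}(g,g)$ is nonsingular. Suppose $$\Delta(\lambda,\lambda'):=\mathrm{EI}_m^{\mathrm{marg}}(\lambda)-\mathrm{EI}_m^{\mathrm{marg}}(\lambda')>0.$$ Let $S\ge1$, let $\theta^{(1)},\dots,\theta^{(S)}$ be i.i.d. with density $q_{m,t}$, and set $$\widehat\Delta_{\mathrm{MC}}(\lambda,\lambda')=\frac1S\sum_{s=1}^S\big[\mathrm{EI}_m(\lambda;\theta^{(s)})-\mathrm{EI}_m(\lambda';\theta^{(s)})\big],\qquad \widehat\Delta_{\mathrm{orth}}(\lambda,\lambda')=\frac1S\sum_{s=1}^S\big[\mathrm{EI}_m^{\mathrm{orth}}(\lambda;\theta^{(s)})-\mathrm{EI}_m^{\mathrm{orth}}(\lambda';\theta^{(s)})\big].$$ Then both estimators are unbiased for $\Delta(\lambda,\lambda')$, and $$\mathbb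{P}\big(\widehat\Delta_{\mathrm{orth}}(\lambda,\lambda')\le0\big)\le\frac{\operatorname{Var}(\widehat\Delta_{\mathrm{orth}}(\lambda,\lambda'))}{\operatorname{Var}(\widehat\Delta_{\mathrm{orth}}(\lambda,\lambda'))+\Delta(\lambda,\lambda')^2}\le\frac{\operatorname{Var}(\widehat\Delta_{\mathrm{MC}}(\lambda,\lambda'))}{\operatorname{Var}(\widehat\Delta_{\mathrm{MC}}(\lambda,\lambda'))+\Delta(\lambda,\lambda')^2}.$$
   Context: $\Lambda\subseteq\mathbb{R}^d$ is a search space. The data at iteration $t$ are $\mathcal{D}_t=\{(\lambda_i,y_i)\}_{i=1}^t$, and $f^\star=\min_{i\le t}y_i$. A surrogate model $m$ has a parameter $\theta\in\Theta\subseteq\mathbb{R}^{d_\theta}$; for each $\theta$ it specifies a predictive distribution of $f(\lambda)$ given $\mathcal{D}_t$ and $\theta$. The expected improvement is $\mathrm{EI}_m(\lambda;\theta)=\mathbb{E}[(f^\star-f(\lambda))_+\mid\mathcal{D}_t,\theta]$, $(x)_+=\max\{0,x\}$, regarded as a real-valued measurable function of $\theta$. The (approximate) posterior over parameters is a probability density $q_{m,t}$, positive on $\Theta$. The marginal EI is $\mathrm{EI}_m^{\mathrm{marg}}(\lambda)=\mathbb{E}_{\theta\sim q_{m,t}}[\mathrm{EI}_m(\lambda;\theta)]$. The orthogonalized EI is $\mathrm{EI}_m^{\mathrm{orth}}(\lambda;\theta)=\mathrm{EI}_m(\lambda;\theta)-\gamma_m(\lambda)^\top g(\theta)$ with $\gamma_m(\lambda)=\Sigma_g^{-1}\operatorname{Cov}_{q_{m,t}}(g,\mathrm{EI}_m(\lambda;\cdot))$,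 where $\operatorname{Cov}_{q_{m,t}}(g,h)\in\mathbb{R}^{d_\theta}$ for scalar $h$ has entries $\operatorname{Cov}(g_j(\theta),h(\theta))$, $\theta\sim q_{m,t}$. *)

(* Defs.v *)
From HB Require Import structures.
From mathcomp Require Import all_boot all_order all_algebra.
From mathcomp Require Import all_classical all_reals all_analysis.

Set Implicit Arguments.
Unset Strict Implicit.
Unset Printing Implicit Defensive.
Import Order.TTheory GRing.Theory Num.Theory.
Import numFieldNormedType.Exports.

Local Open Scope classical_set_scope.
Local Open Scope ring_scope.

Definition measure_rV_display : measure_display. Proof. by constructor. Qed.

(* The sigma-algebra generated by the coordinates: the Borel sets of R^n. *)
Section measurable_rV.
Variables (R : realType) (n : nat).

Let coords (i : 'I_n) (v : 'rV[R]_n) : R := v ord0 i.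

Let rV_set0 : g_sigma_preimage coords set0.
Proof. exact: sigma_algebra0. Qed.

Let rV_setC A : g_sigma_preimage coords A -> g_sigma_preimage coords (~` A).
Proof. exact: sigma_algebraC. Qed.

Let rV_bigcup (F : _^nat) : (forall i, g_sigma_preimage coords (F i)) ->
  g_sigma_preimage coords (\bigcup_i (F i)).
Proof. exact: sigma_algebra_bigcup. Qed.

HB.instance Definition _ := @isMeasurable.Build measure_rV_display
  'rV[R]_n (g_sigma_preimage coords) rV_set0 rV_setC rV_bigcup.

Lemma measurable_coord (i : 'I_n) :
  measurable_fun [set: 'rV[R]_n] (fun v : 'rV[R]_n => v ord0 i).
Proof.
move=> _ Y mY; rewrite setTI; apply: sub_sigma_algebra => /=.
rewrite -bigcup_seq/=; exists i => /=; first by rewrite mem_index_enum.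
by exists Y => //; rewrite setTI.
Qed.

Lemma measurable_fun_rVP d (T : measurableType d) (f : T -> 'rV[R]_n) :
  (forall i, measurable_fun [set: T] (fun x => f x ord0 i)) ->
  measurable_fun [set: T] f.
Proof.
move=> mf _ A mA; rewrite setTI.
have : g_sigma_preimage (fun i => coords i \o f) `<=` measurable.
  apply: smallest_sub; first exact: sigma_algebra_measurable.
  rewrite -bigcup_seq; apply: bigcup_sub => i _ _ [B mB <-].
  exact: mf.
rewrite g_sigma_preimage_comp => /(_ (f @^-1` A)); apply.
by exists A => //; rewrite setTI.
Qed.

End measurable_rV.

Section lebesgue_rV.
Variable R : realType.

Definition cons_rV n (p : R * 'rV[R]_n) : 'rV[R]_n.+1 :=
  row_mx (p.1%:M : 'rV[R]_1) p.2.

Definition uncons_rV n (v : 'rV[R]_n.+1) : R * 'rV[R]_n :=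
  (v ord0 ord0, rsubmx (v : 'rV[R]_(1 + n))).

Lemma cons_rVE0 n (p : R * 'rV[R]_n) : cons_rV p ord0 ord0 = p.1.
Proof.
transitivity (cons_rV p ord0 (lshift n (ord0 : 'I_1))).
  by congr (cons_rV p _ _); apply/val_inj.
by apply: (etrans (row_mxEl _ _ _ _)); rewrite mxE eqxx.
Qed.

Lemma cons_rVES n (p : R * 'rV[R]_n) (j : 'I_n) :
  cons_rV p ord0 (lift ord0 j) = p.2 ord0 j.
Proof.
transitivity (cons_rV p ord0 (rshift 1 j)).
  by congr (cons_rV p _ _); apply/val_inj.
exact: (row_mxEr (p.1%:M : 'rV[R]_1)).
Qed.

Lemma cons_rVK n : cancel (@cons_rV n) (@uncons_rV n).
Proof.
by move=> p; rewrite /uncons_rV cons_rVE0 /cons_rV row_mxKr -surjective_pairing.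
Qed.

Lemma measurable_cons_rV n : measurable_fun [set: R * 'rV[R]_n] (@cons_rV n).
Proof.
apply: measurable_fun_rVP => i; case: (unliftP ord0 i) => [j|] ->.
- under eq_fun do rewrite cons_rVES.
  exact: (measurableT_comp (measurable_coord j) measurable_snd).
- under eq_fun do rewrite cons_rVE0; exact: measurable_fst.
Qed.

Lemma measurable_uncons_rV n : measurable_fun [set: 'rV[R]_n.+1] (@uncons_rV n).
Proof.
apply/measurable_fun_pairP; split; first exact: measurable_coord.
apply: measurable_fun_rVP => i /=.
under eq_fun do rewrite mxE; exact: measurable_coord.
Qed.

Section lebesgue_cons.
Variables (n : nat) (m : {sigma_finite_measure set 'rV[R]_n -> \bar R}).

Definition lebesgue_cons : set 'rV[R]_n.+1 -> \bar R :=
  pushforward (@lebesgue_measure R \x m)%E (@cons_rV n).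

Let lebesgue_cons0 : lebesgue_cons set0 = 0%E.
Proof. by rewrite /lebesgue_cons /pushforward preimage_set0 measure0. Qed.

Let lebesgue_cons_ge0 A : (0 <= lebesgue_cons A)%E.
Proof. by rewrite /lebesgue_cons /pushforward measure_ge0. Qed.

Let preim_cons (A : set 'rV[R]_n.+1) :
  measurable A -> measurable (@cons_rV n @^-1` A).
Proof.
by move=> mA; rewrite -[X in measurable X]setTI; exact: measurable_cons_rV.
Qed.

Let lebesgue_cons_sigma_additive : semi_sigma_additive lebesgue_cons.
Proof.
move=> F mF tF mUF; rewrite /lebesgue_cons /pushforward preimage_bigcup.
apply: measure_semi_sigma_additive.
- by move=> k; exact: preim_cons.
- apply/trivIsetP => /= i j _ _ ij; rewrite -preimage_setI.
  by move/trivIsetP : tF => /(_ _ _ _ _ ij) ->//; rewrite preimage_set0.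
- by rewrite -preimage_bigcup; exact: preim_cons.
Qed.

HB.instance Definition _ := isMeasure.Build _ _ _ lebesgue_cons
  lebesgue_cons0 lebesgue_cons_ge0 lebesgue_cons_sigma_additive.

Let lebesgue_cons_sigma_finite : sigma_finite setT lebesgue_cons.
Proof.
have /sigma_finiteP[F [TF ndF Foo]] := sigma_finiteT (@lebesgue_measure R).
have /sigma_finiteP[G [TG ndG Goo]] := sigma_finiteT m.
exists (fun k => @uncons_rV n @^-1` (F k `*` G k)).
  apply/seteqP; split => // v _.
  have [k _ Fk] : (\bigcup_k F k) (uncons_rV v).1 by rewrite -TF.
  have [l _ Gl] : (\bigcup_l G l) (uncons_rV v).2 by rewrite -TG.
  exists (maxn k l) => //; split.
  - by move: Fk; exact/subsetPset/ndF/leq_maxl.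
  - by move: Gl; exact/subsetPset/ndG/leq_maxr.
move=> k; have [mF Fk] := Foo k; have [mG Gk] := Goo k; split.
  rewrite -[X in measurable X]setTI; apply: measurable_uncons_rV => //.
  exact: measurableX.
rewrite /lebesgue_cons /pushforward -comp_preimage.
rewrite (_ : _ \o _ = id) ?preimage_id; last first.
  by apply/funext => p /=; rewrite cons_rVK.
by rewrite product_measure1E// lte_mul_pinfty// ge0_fin_numE.
Qed.

HB.instance Definition _ := Measure_isSigmaFinite.Build _ _ _ lebesgue_cons
  lebesgue_cons_sigma_finite.

End lebesgue_cons.

(* Lebesgue measure on R^n as an iterated product; [lebesgue_rV_box] below is
   the characterization on boxes. *)
Fixpoint lebesgue_rV n : {sigma_finite_measure set 'rV[R]_n -> \bar R} :=
  match n with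
  | 0 => (\d_(0 : 'rV[R]_0) : {sigma_finite_measure set _ -> \bar R})
  | n'.+1 => (lebesgue_cons (lebesgue_rV n') :
                {sigma_finite_measure set _ -> \bar R})
  end.

Lemma lebesgue_rV_box n (A : 'I_n -> set R) : (forall i, measurable (A i)) ->
  lebesgue_rV n [set v | forall i, A i (v ord0 i)]
  = (\prod_(i < n) lebesgue_measure (A i))%E.
Proof.
elim: n A => [|n IHn] A mA.
  by rewrite big_ord0 /= diracE mem_set//= => -[].
pose B := [set v : 'rV[R]_n | forall i, A (lift ord0 i) (v ord0 i)].
have mB : measurable B.
  rewrite (_ : B = \big[setI/setT]_(i < n)
      ((fun v : 'rV[R]_n => v ord0 i) @^-1` A (lift ord0 i))).
    apply: bigsetI_measurable => i _.
    by rewrite -[X in measurable X]setTI; exact: measurable_coord.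
  apply/seteqP; split => v; rewrite -bigcap_seq/= => Bv i.
  - by move=> _; exact: Bv.
  - by apply: Bv; rewrite /= mem_index_enum.
rewrite big_ord_recl /= /lebesgue_cons /pushforward.
rewrite (_ : _ @^-1` _ = A ord0 `*` B).
  rewrite product_measure1E//; last exact: mA.
  by congr (_ * _)%E; apply: IHn => i; exact: mA.
apply/seteqP; split => -[x v] /= Av.
- split; first by have := Av ord0; rewrite cons_rVE0.
  by move=> i; have := Av (lift ord0 i); rewrite cons_rVES.
- move=> i; case: (unliftP ord0 i) => [j|] ->.
  + by rewrite cons_rVES; exact: Av.2.
  + by rewrite cons_rVE0; exact: Av.1.
Qed.

End lebesgue_rV.

Section gradient.
Variables (R : realType) (n : nat).

Definition grad (f : 'rV[R]_n -> R) (x : 'rV[R]_n) : 'cV[R]_n :=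
  \col_j 'D_(delta_mx ord0 j) f x.

Definition norm2 (v : 'cV[R]_n) : R := Num.sqrt (\sum_j v j ord0 ^+ 2).

End gradient.

Definition mutually_independent d d' (T : measurableType d)
    (T' : measurableType d') (R : realType) (P : probability T R)
    (S : nat) (X : 'I_S -> T -> T') :=
  forall (J : {set 'I_S}) (A : 'I_S -> set T'),
    (forall i, i \in J -> measurable (A i)) ->
    P (\bigcap_(i in [set i | i \in J]) (X i @^-1` A i)) =
    (\prod_(i in J) P (X i @^-1` A i))%E.

Section surrogate.
Variables (R : realType) (d n : nat).

(* [predictive D theta l] is only meaningful for [theta] in [params]. *)
Record surrogate := Surrogate {
  params : set 'rV[R]_n ;
  predictive : forall t, t.-tuple ('rV[R]_d * R) -> 'rV[R]_n -> 'rV[R]_d ->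
    probability (measurableTypeR R) R }.

Variables (t : nat) (D : t.-tuple ('rV[R]_d * R)).

Definition best_value : R :=
  let ys := [seq p.2 | p <- D] in \big[Num.min/head 0 ys]_(y <- ys) y.

Variable m : surrogate.

Definition EIe (l : 'rV[R]_d) (theta : 'rV[R]_n) : \bar R :=
  'E_(predictive m D theta l)[fun y => Num.max 0 (best_value - y)].

(* The value 0 outside [params m] is a convention: the posterior does not
   charge the complement of [params m]. *)
Definition EI (l : 'rV[R]_d) : 'rV[R]_n -> R :=
  (fun theta => fine (EIe l theta)) \_ (params m).

End surrogate.

Section posterior.
Variables (R : realType) (n : nat) (Theta : set 'rV[R]_n) (q : 'rV[R]_n -> R).

Definition pos_prob_density :=
  [/\ measurable Theta, measurable_fun Theta q,
      forall x, Theta x -> 0 < q x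
    & (\int[lebesgue_rV R n]_(x in Theta) (q x)%:E = 1)%E].

Definition has_density (Q : probability 'rV[R]_n R) :=
  forall A, measurable A ->
    Q A = (\int[lebesgue_rV R n]_(x in A `&` Theta) (q x)%:E)%E.

(* Set to 0 off [Theta], as for [EI]. *)
Definition score : 'rV[R]_n -> 'cV[R]_n :=
  (grad (fun x => ln (q x))) \_ Theta.

End posterior.

Section orthogonalized.
Variables (R : realType) (n : nat) (Q : probability 'rV[R]_n R).
Variable (g : 'rV[R]_n -> 'cV[R]_n).

Definition cov_vec (h : 'rV[R]_n -> R) : 'cV[R]_n :=
  \col_j fine (covariance Q (fun x => g x j ord0) h).

Definition cov_mx : 'M[R]_n :=
  \matrix_(i, j)
    fine (covariance Q (fun x => g x i ord0) (fun x => g x j ord0)).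

Definition gamma (h : 'rV[R]_n -> R) : 'cV[R]_n := invmx cov_mx *m cov_vec h.

Definition orthogonalize (h : 'rV[R]_n -> R) (x : 'rV[R]_n) : R :=
  h x - ((gamma h)^T *m g x) ord0 ord0.

End orthogonalized.

Definition sample_diff (T U : Type) (R : realType) (S : nat)
    (theta : 'I_S -> T -> U) (h h' : U -> R) (w : T) : R :=
  S%:R^-1 * \sum_(s < S) (h (theta s w) - h' (theta s w)).

(* Main.v *)
(* The score has mean zero under [Q], so subtracting a linear combination of its
   entries leaves every mean unchanged.  The coefficient [gamma] is the
   least-squares one: the residual of [EI] is uncorrelated with every entry of
   the score, so the variance of [EI] is the sum of the variances of the residual
   and of the fitted part.  [orthogonalize] is linear, so the same holds for the
   difference of two [EI]s, and averaging over an i.i.d. sample divides both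
   variances by [S].  The tail bound is Cantelli's inequality, whose right-hand
   side [v / (v + Delta ^+ 2)] is nondecreasing in [v]. *)

Require Import Defs.
From HB Require Import structures.
From mathcomp Require Import all_boot all_order all_algebra.
From mathcomp Require Import all_classical all_reals all_analysis.
From mathcomp Require Import measurable_realfun.

Set Implicit Arguments.
Unset Strict Implicit.
Unset Printing Implicit Defensive.
Import Order.TTheory GRing.Theory Num.Theory.
Import numFieldNormedType.Exports.

Local Open Scope classical_set_scope.
Local Open Scope ring_scope.

(** * Square-integrable variables and the bilinearity of covariance *)

Section square_integrable.
Context d (T : measurableType d) (R : realType) (P : probability T R).
Implicit Types X Y Z : T -> R.

Lemma Lfun2_Lfun1 X : X \in Lfun P 2%:E -> X \in Lfun P 1.
Proof. exact/Lfun_subset12/fin_num_measure. Qed.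

Lemma Lfun2_measurable X : X \in Lfun P 2%:E -> measurable_fun [set: T] X.
Proof. by move=> /andP[/[!inE]]. Qed.

(** Entry point from the second-moment hypotheses of the theorem to the $L^2$ calculus. *)
Lemma Lfun2_expectation_sqr X : measurable_fun [set: T] X ->
  ('E_P[fun w => (X w ^+ 2)%R] < +oo)%E -> X \in Lfun P 2%:E.
Proof.
move=> mX; rewrite unlock => EX2.
rewrite inE; apply/andP; split; rewrite inE//= /finite_norm unlock.
apply: poweR_lty; apply: le_lt_trans EX2.
rewrite le_eqVlt; apply/orP; left; apply/eqP; apply: eq_integral => x _ /=.
by rewrite powR_mulrn// real_normK// num_real.
Qed.

Lemma Lfun2Z a X : X \in Lfun P 2%:E -> (fun w => a * X w) \in Lfun P 2%:E.
Proof.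
move=> X2; rewrite (_ : (fun w => a * X w) = a \o* X); last first.
  by apply/funext => w /=; rewrite mulrC.
by apply: Lfun_scale; rewrite ?ler1n.
Qed.

Lemma Lfun2D X Y : X \in Lfun P 2%:E -> Y \in Lfun P 2%:E ->
  (fun w => X w + Y w) \in Lfun P 2%:E.
Proof. by move=> X2 Y2; apply: (rpredD X2 Y2); rewrite lee1n. Qed.

Lemma Lfun2B X Y : X \in Lfun P 2%:E -> Y \in Lfun P 2%:E ->
  (fun w => X w - Y w) \in Lfun P 2%:E.
Proof. by move=> X2 Y2; apply: (rpredB X2 Y2); rewrite lee1n. Qed.

Lemma Lfun2_sum (I : Type) (s : seq I) (F : I -> T -> R) :
  (forall i, F i \in Lfun P 2%:E) ->
  (fun w => \sum_(i <- s) F i w) \in Lfun P 2%:E.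
Proof.
move=> F2; elim: s => [|i s IHs].
  under eq_fun do rewrite big_nil; exact: (Lfun_cst P 0 2).
by under eq_fun do rewrite big_cons; exact: Lfun2D.
Qed.

(** Real-valued, so that it matches the entries of [cov_vec] and [cov_mx]; on $L^2$ the covariance
    is finite and [fine] loses nothing ([EFin_cov]). *)
Definition cov X Y : R := fine (covariance P X Y).

Lemma EFin_cov X Y : X \in Lfun P 2%:E -> Y \in Lfun P 2%:E ->
  (cov X Y)%:E = covariance P X Y.
Proof.
move=> X2 Y2; rewrite fineK// covariance_fin_num//; last exact: Lfun2_mul_Lfun1.
all: exact: Lfun2_Lfun1.
Qed.

Lemma covC X Y : cov X Y = cov Y X.
Proof. by rewrite /cov covarianceC. Qed.

Lemma covDl X Y Z :
  X \in Lfun P 2%:E -> Y \in Lfun P 2%:E -> Z \in Lfun P 2%:E ->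
  cov (fun w => X w + Y w) Z = cov X Z + cov Y Z.
Proof.
move=> X2 Y2 Z2; apply: EFin_inj; rewrite EFinD !EFin_cov//; last exact: Lfun2D.
exact: covarianceDl.
Qed.

Lemma covBl X Y Z :
  X \in Lfun P 2%:E -> Y \in Lfun P 2%:E -> Z \in Lfun P 2%:E ->
  cov (fun w => X w - Y w) Z = cov X Z - cov Y Z.
Proof.
move=> X2 Y2 Z2; apply: EFin_inj; rewrite EFinB !EFin_cov//; last exact: Lfun2B.
exact: covarianceBl.
Qed.

Lemma covZl a X Z : X \in Lfun P 2%:E -> Z \in Lfun P 2%:E ->
  cov (fun w => a * X w) Z = a * cov X Z.
Proof.
move=> X2 Z2; apply: EFin_inj; rewrite EFinM !EFin_cov//; last exact: Lfun2Z.
rewrite (_ : (fun w => a * X w) = a \o* X); last first.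
  by apply/funext => w /=; rewrite mulrC.
rewrite covarianceZl//; try exact: Lfun2_Lfun1.
exact: Lfun2_mul_Lfun1.
Qed.

Lemma cov_suml (I : Type) (s : seq I) (F : I -> T -> R) Z :
  (forall i, F i \in Lfun P 2%:E) -> Z \in Lfun P 2%:E ->
  cov (fun w => \sum_(i <- s) F i w) Z = \sum_(i <- s) cov (F i) Z.
Proof.
move=> F2 Z2; elim: s => [|i s IHs].
  under eq_fun do rewrite big_nil.
  by rewrite big_nil /cov (covariance_cst_l P 0).
under eq_fun do rewrite big_cons.
by rewrite big_cons covDl ?IHs//; exact: Lfun2_sum.
Qed.

(** The variance of the sum expands with a vanishing cross term, and the variance of [Y] is
    nonnegative. *)
Lemma variance_le_uncorrelatedD X Y :
  X \in Lfun P 2%:E -> Y \in Lfun P 2%:E -> cov X Y = 0 ->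
  ('V_P[X] <= 'V_P[(fun w => X w + Y w)%R])%E.
Proof.
move=> X2 Y2 XY0; rewrite (varianceD X2 Y2) -EFin_cov// XY0 mule0 adde0.
by rewrite leeDl// variance_ge0.
Qed.

Lemma expectationZ2 a X : X \in Lfun P 2%:E ->
  ('E_P[(fun w => a * X w)%R] = a%:E * 'E_P[X])%E.
Proof.
move=> X2; rewrite -expectationZl; last exact: Lfun2_Lfun1.
by congr expectation; apply/funext => w /=; rewrite mulrC.
Qed.

Lemma expectation_sum2 (I : Type) (s : seq I) (F : I -> T -> R) :
  (forall i, F i \in Lfun P 2%:E) ->
  ('E_P[(fun w => \sum_(i <- s) F i w)%R] = \sum_(i <- s) 'E_P[F i])%E.
Proof.
move=> F2; elim: s => [|i s IHs].
  under eq_fun do rewrite big_nil.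
  by rewrite big_nil (expectation_cst P 0).
under eq_fun do rewrite big_cons.
rewrite big_cons -IHs -expectationD//; apply: Lfun2_Lfun1 => //.
exact: Lfun2_sum.
Qed.

End square_integrable.

(** * Moments computed from the law, and covariance under independence *)

Section law.
Context d d' (T : measurableType d) (T' : measurableType d') (R : realType).
Variables (P : probability T R) (Q : probability T' R).

Section transfer.
Variable X : {RV P >-> T'}.
Hypothesis XQ : forall A, measurable A -> distribution P X A = Q A.

(** Nonnegativity replaces integrability here, so this can serve to prove that second moments are
    finite. *)
Lemma ge0_integral_law (f : T' -> \bar R) : measurable_fun [set: T'] f ->
  (forall y, (0 <= f y)%E) -> (\int[P]_w f (X w) = \int[Q]_y f y)%E.
Proof.
move=> mf f0; rewrite -(ge0_integral_distribution X)//.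
by apply: eq_measure_integral => A mA _; exact: XQ.
Qed.

Lemma Lfun2_law h : h \in Lfun Q 2%:E -> (h \o X) \in Lfun P 2%:E.
Proof.
move=> h2; have mh := Lfun2_measurable h2.
apply: Lfun2_expectation_sqr; first exact: measurableT_comp.
have /integrableP[_] := Lfun2_integrable_sqr h2.
rewrite unlock /= => /(le_lt_trans _); apply.
have mh2 : measurable_fun [set: T'] (fun y => (h y ^+ 2)%:E).
  by apply/measurable_EFinP; exact: measurable_funX.
rewrite (ge0_integral_law (f := fun y => (h y ^+ 2)%:E)) => [|//|y]; last first.
  by rewrite lee_fin sqr_ge0.
rewrite le_eqVlt; apply/orP; left; apply/eqP; apply: eq_integral => y _ /=.
by rewrite ger0_norm// sqr_ge0.
Qed.

Lemma expectation_law h : h \in Lfun Q 2%:E -> ('E_P[h \o X] = 'E_Q[h])%E.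
Proof.
move=> h2; rewrite unlock.
transitivity (\int[distribution P X]_y (h y)%:E)%E.
  rewrite integral_distribution//.
    by apply/measurable_EFinP; exact: Lfun2_measurable h2.
  by apply/Lfun1_integrable/Lfun2_Lfun1; exact: Lfun2_law.
by apply: eq_measure_integral => A mA _; exact: XQ.
Qed.

Lemma variance_law h : h \in Lfun Q 2%:E -> ('V_P[h \o X] = 'V_Q[h])%E.
Proof.
move=> h2; have mh := Lfun2_measurable h2.
rewrite /variance !covariance.unlock (expectation_law h2).
set e := fine _; rewrite !expectation.unlock.
apply: (ge0_integral_law (f := fun y => ((h y - e) * (h y - e))%:E)).
  by apply/measurable_EFinP; apply: measurable_funM; exact: measurable_funB.
by move=> y; rewrite lee_fin -expr2 sqr_ge0.
Qed.

End transfer.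

(** Named so that a measurability instance can be attached, which makes its distribution the joint
    law. *)
Definition pair_rv (X Y : T -> T') (w : T) := (X w, Y w).

HB.instance Definition _ (X Y : {mfun T >-> T'}) :=
  isMeasurableFun.Build _ _ _ _ (pair_rv X Y)
    (measurable_fun_pair (measurable_funPT X) (measurable_funPT Y)).

(* The joint law of [(X, Y)] agrees with [Q \x Q] on rectangles, hence
   everywhere, and Fubini factors the mean of the product. *)
Lemma cov_independent (X Y : {RV P >-> T'}) h :
  (forall A, measurable A -> distribution P X A = Q A) ->
  (forall A, measurable A -> distribution P Y A = Q A) ->
  (forall A B, measurable A -> measurable B ->
    P (X @^-1` A `&` Y @^-1` B) = (Q A * Q B)%E) ->
  h \in Lfun Q 2%:E -> cov P (h \o X) (h \o Y) = 0.
Proof.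
move=> XQ YQ XYQ h2; have mh := Lfun2_measurable h2.
have hX2 := Lfun2_law XQ h2; have hY2 := Lfun2_law YQ h2.
pose XY : {RV P >-> (T' * T')%type} := pair_rv X Y.
pose f (z : T' * T') := (h z.1 * h z.2)%:E.
have mf : measurable_fun [set: T' * T'] f.
  by apply/measurable_EFinP/measurable_funM; exact: measurableT_comp.
have fXY : P.-integrable [set: T] (f \o XY).
  by have /Lfun1_integrable := Lfun2_mul_Lfun1 hX2 hY2.
have prodE A : measurable A -> (Q \x Q)%E A = distribution P XY A.
  by apply: (product_measure_unique (m1 := Q) (m2 := Q)) => B C mB mC; rewrite -XYQ.
(* Fubini needs integrability under the product measure; it is carried over from [P], where a
   product of two $L^2$ functions is integrable. *)
have fQ : (Q \x Q)%E.-integrable [set: T' * T'] f.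
  apply/integrableP; split => //.
  rewrite (eq_measure_integral (distribution P XY)); last first.
    by move=> A mA _; exact: prodE.
  rewrite ge0_integral_distribution//; last exact: measurableT_comp.
  by have /integrableP[] := fXY.
have Ehh : ('E_P[(h \o X) * (h \o Y)] = 'E_Q[h] * 'E_Q[h])%E.
  transitivity (\int[distribution P XY]_z f z)%E.
    by rewrite integral_distribution// unlock.
  rewrite -(eq_measure_integral _ (fun A mA _ => prodE A mA)).
  rewrite -integral12_prod_meas1// /fubini_F /f /=.
  (* One of the two means is made real, so that it can enter the outer integral as a constant
     factor. *)
  rewrite -{2}(fineK (expectation_fin_num (Lfun2_Lfun1 h2))).
  rewrite unlock -integralZr//; last exact/Lfun1_integrable/Lfun2_Lfun1.
  apply: eq_integral => x _.
  under eq_integral do rewrite EFinM.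
  rewrite integralZl//; last exact/Lfun1_integrable/Lfun2_Lfun1.
  rewrite fineK//; have := expectation_fin_num (Lfun2_Lfun1 h2).
  by rewrite unlock.
rewrite /cov covarianceE; [|exact: Lfun2_Lfun1..|exact: Lfun2_mul_Lfun1].
by rewrite Ehh !(expectation_law _ h2)// subee// fin_numM// expectation_fin_num//;
  exact: Lfun2_Lfun1.
Qed.

End law.

(** * Integration against a density *)

Section density.
Context d (T : measurableType d) (R : realType).
Variables (mu : {sigma_finite_measure set T -> \bar R}) (Q : probability T R).
Variables (D : set T) (q : T -> R).
Hypotheses (mD : measurable D) (mq : measurable_fun D q).
Hypothesis q_ge0 : forall x, D x -> 0 <= q x.
Hypothesis Qq : forall A, measurable A ->
  Q A = (\int[mu]_(x in A `&` D) (q x)%:E)%E.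

(* The library's change of variables is stated for its chosen Radon-Nikodym
   derivative, which is a.e. equal to the density [q]. *)
Lemma integral_density f : Q.-integrable [set: T] f ->
  (\int[Q]_x f x = \int[mu]_(x in D) (f x * (q x)%:E))%E.
Proof.
move=> intf.
have mqE : measurable_fun D (EFin \o q) by exact/measurable_EFinP.
have Qmu : Q `<< mu.
  apply/null_content_dominatesP => A mA muA0; rewrite Qq//.
  apply: null_set_integral => //; first exact: measurableI.
    exact: measurable_funS mqE.
  by apply/eqP; rewrite -measure_le0 -muA0; apply: le_measure; rewrite ?inE//;
    exact: measurableI.
(* The density extended by zero, to be compared with the Radon-Nikodym derivative on the whole
   space. *)
pose p : T -> \bar R := (EFin \o q) \_ D.
have mp : measurable_fun [set: T] p by exact/(measurable_restrictT _ mD).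
have intp : mu.-integrable [set: T] p.
  apply/(integrable_mkcond _ mD); apply/integrableP; split => //.
  under eq_integral => x /[!inE] Dx do rewrite gee0_abs ?lee_fin ?q_ge0//.
  by rewrite -[D]setTI -Qq// probability_setT ltry.
rewrite -(Radon_Nikodym_change_of_variables Qmu measurableT intf).
rewrite [RHS]integral_mkcond.
have mf := measurable_int _ intf.
transitivity (\int[mu]_x (f x * p x))%E; last first.
  apply: eq_integral => x _; rewrite /p !patchE.
  by case: ifPn => //; rewrite mule0.
apply: ae_eq_integral => //; [exact: emeasurable_funM..|].
(* Both functions integrate to [Q A] over every measurable [A]. *)
have : ae_eq mu [set: T] p (Radon_Nikodym (charge_of_finite_measure Q) mu).
  apply: integral_ae_eq => // A _ mA.
  by rewrite -Radon_Nikodym_integral//= Qq// -integral_mkcondr.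
by apply: filterS => x /= px /px ->.
Qed.

End density.

(** * The score: measurability, square integrability, mean zero *)

Section score.
Context (R : realType) (n : nat).

Lemma grad_ln (q : 'rV[R]_n -> R) x j : differentiable q x -> 0 < q x ->
  grad (fun y => ln (q y)) x j ord0 = grad q x j ord0 / q x.
Proof.
move=> dq q0; rewrite !mxE.
have dln : differentiable (@ln R) (q x).
  by apply/derivable1_diffP; have [] := is_derive1_ln q0.
rewrite (_ : (fun y => ln (q y)) = @ln R \o q)// deriveE; last first.
  exact: differentiable_comp.
rewrite diff_comp//= (deriveE _ dq).
(* The increment [v] passed to the differential of [ln] is written [v *: 1]; linearity pulls [v] out
   and leaves the derivative of [ln]. *)
rewrite -[X in 'd _ _ X]mulr1 -[X in 'd _ _ X]/('d q x (delta_mx ord0 j) *: 1).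
rewrite linearZ -(deriveE _ dln); congr (_ * _).
by have /@derive_val := is_derive1_ln q0.
Qed.

Variables (Theta : set 'rV[R]_n) (q : 'rV[R]_n -> R) (Q : probability 'rV[R]_n R).
Hypotheses (qTheta : pos_prob_density Theta q) (Qq : has_density Theta q Q).
Hypothesis dq : forall x, Theta x -> differentiable q x.
Hypothesis intgrad : forall j, (lebesgue_rV R n).-integrable Theta
  (fun x => (grad q x j ord0)%:E).

Lemma scoreE j : (fun x => score Theta q x j ord0) =
  (fun x => grad q x j ord0 / q x) \_ Theta.
Proof.
case: qTheta => _ _ q0 _.
apply/funext => x; rewrite /score !patchE; case: ifPn => [/set_mem Tx|_].
  by rewrite grad_ln//; [exact: dq|exact: q0].
by rewrite mxE.
Qed.

(** In the quotient form, the numerator is measurable because it is integrable on [Theta]. *)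
Lemma measurable_score j :
  measurable_fun [set: 'rV[R]_n] (fun x => score Theta q x j ord0).
Proof.
case: qTheta => mTheta mq q0 _.
rewrite scoreE; apply/(measurable_restrictT _ mTheta); apply: measurable_funM.
  by apply/measurable_EFinP; exact: measurable_int (intgrad j).
(* On [Theta], where [q] is positive, the inverse is the real power of exponent -1, a measurable
   function. *)
apply: (eq_measurable_fun (fun x => q x `^ (-1))).
  by move=> x /set_mem Tx; rewrite powR_inv1// ltW// q0.
by apply: (@measurableT_comp _ _ _ _ _ _ (@powR R ^~ (-1))).
Qed.

(** The square of one entry is dominated by the squared norm. *)
Lemma Lfun2_score j :
  ('E_Q[fun x => (norm2 (score Theta q x) ^+ 2)%R] < +oo)%E ->
  (fun x => score Theta q x j ord0) \in Lfun Q 2%:E.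
Proof.
move=> Eg; apply: Lfun2_expectation_sqr; first exact: measurable_score.
have norm2E x : norm2 (score Theta q x) ^+ 2 =
    \sum_i score Theta q x i ord0 ^+ 2.
  by rewrite sqr_sqrtr//; apply: sumr_ge0 => i _; exact: sqr_ge0.
apply: le_lt_trans Eg; apply: expectation_le.
- by apply: measurable_funX; exact: measurable_score.
- under eq_fun do rewrite norm2E.
  by apply: measurable_sum => i; apply: measurable_funX; exact: measurable_score.
- by move=> x; exact: sqr_ge0.
- by move=> x; exact: sqr_ge0.
- apply: aeW => x; rewrite norm2E (bigD1 j)//= lerDl.
  by apply: sumr_ge0 => i _; exact: sqr_ge0.
Qed.

(** The density cancels the denominator of the score, leaving the integral of the gradient of
    [q]. *)
Lemma expectation_score j :
  (fun x => score Theta q x j ord0) \in Lfun Q 2%:E ->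
  (\int[lebesgue_rV R n]_(x in Theta) (grad q x j ord0)%:E = 0)%E ->
  ('E_Q[fun x => score Theta q x j ord0] = 0)%E.
Proof.
case: qTheta => mTheta mq q0 _ g2 grad0.
rewrite unlock (integral_density mTheta mq _ Qq).
- rewrite -[RHS]grad0; apply: eq_integral => x xT.
  have Tx := set_mem xT.
  have /(congr1 (@^~ x)) /= -> := scoreE j.
  rewrite patchE xT -EFinM divfK//.
  by rewrite gt_eqF// q0.
- by move=> x Tx; rewrite ltW// q0.
- by apply/Lfun1_integrable/Lfun2_Lfun1.
Qed.

End score.

(** * Orthogonalization as a least-squares residual *)

Section orthogonalization.
Context (R : realType) (n : nat) (Q : probability 'rV[R]_n R).
Variable g : 'rV[R]_n -> 'cV[R]_n.
Hypothesis g2 : forall j, (fun x => g x j ord0) \in Lfun Q 2%:E.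

(** The fitted part as a finite sum of scaled score entries, the shape to which linearity lemmas
    apply. *)
Let dot (c : 'cV[R]_n) (x : 'rV[R]_n) : R := \sum_j c j ord0 * g x j ord0.

Let dotE c x : (c^T *m g x) ord0 ord0 = dot c x.
Proof. by rewrite mxE; apply: eq_bigr => j _; rewrite mxE. Qed.

Let dot2 c : dot c \in Lfun Q 2%:E.
Proof. by apply: Lfun2_sum => j; exact: Lfun2Z. Qed.

Lemma Lfun2_orthogonalize h : h \in Lfun Q 2%:E ->
  orthogonalize Q g h \in Lfun Q 2%:E.
Proof.
move=> h2; rewrite (_ : orthogonalize Q g h = fun x => h x - dot (gamma Q g h) x).
  exact: Lfun2B.
by apply/funext => x; rewrite /orthogonalize dotE.
Qed.

Lemma expectation_orthogonalize h : h \in Lfun Q 2%:E ->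
  (forall j, ('E_Q[fun x => g x j ord0] = 0)%E) ->
  ('E_Q[orthogonalize Q g h] = 'E_Q[h])%E.
Proof.
move=> h2 Eg.
rewrite (_ : orthogonalize Q g h = h \- dot (gamma Q g h)); last first.
  by apply/funext => x; rewrite /orthogonalize dotE.
rewrite expectationB; [|exact: Lfun2_Lfun1..].
rewrite expectation_sum2 => [|j]; last exact: Lfun2Z.
by rewrite big1 ?sube0// => j _; rewrite expectationZ2// Eg mule0.
Qed.

(** Covariance is linear in its second argument, hence so is [gamma]. This reduces the comparison of
    two candidates to a single function. *)
Lemma orthogonalizeB h h' : h \in Lfun Q 2%:E -> h' \in Lfun Q 2%:E ->
  orthogonalize Q g (fun x => h x - h' x) =
  (fun x => orthogonalize Q g h x - orthogonalize Q g h' x).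
Proof.
move=> h2 h'2; apply/funext => x; rewrite /orthogonalize.
have -> : gamma Q g (fun x => h x - h' x) = gamma Q g h - gamma Q g h'.
  rewrite /gamma -mulmxBr; congr (_ *m _); apply/colP => j; rewrite !mxE.
  by rewrite -![fine _]/(cov Q _ _) !(covC Q (fun x => g x j ord0)) covBl.
rewrite linearB mulmxBl [in LHS]mxE [X in _ - (_ + X)]mxE.
by rewrite !opprD addrACA.
Qed.

Lemma cov_orthogonalize_score h j : cov_mx Q g \in unitmx ->
  h \in Lfun Q 2%:E ->
  cov Q (orthogonalize Q g h) (fun x => g x j ord0) = 0.
Proof.
move=> Su h2.
rewrite (_ : orthogonalize Q g h = fun x => h x - dot (gamma Q g h) x); last first.
  by apply/funext => x; rewrite /orthogonalize dotE.
rewrite covBl// cov_suml => [|i|//]; last exact: Lfun2Z.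
(* Row [j] of the normal equations; nonsingularity of the covariance matrix enters here. *)
have : (cov_mx Q g *m gamma Q g h) j ord0 = cov_vec Q g h j ord0.
  by rewrite /gamma mulKVmx.
rewrite !mxE -[fine _]/(cov Q _ _) covC => <-.
rewrite -sumrB big1// => i _.
by rewrite covZl// !mxE -[fine _]/(cov Q _ _) covC mulrC subrr.
Qed.

(** Pythagoras: [h] is the residual plus a combination of score entries, each uncorrelated with the
    residual. *)
Lemma variance_orthogonalize_le h : cov_mx Q g \in unitmx ->
  h \in Lfun Q 2%:E -> ('V_Q[orthogonalize Q g h] <= 'V_Q[h])%E.
Proof.
move=> Su h2.
rewrite [in leRHS](_ : h =
    fun x => orthogonalize Q g h x + dot (gamma Q g h) x); last first.
  by apply/funext => x; rewrite /orthogonalize dotE subrK.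
apply: variance_le_uncorrelatedD => //; first exact: Lfun2_orthogonalize.
have o2 := Lfun2_orthogonalize h2.
rewrite covC cov_suml => [|i|//]; last exact: Lfun2Z.
by rewrite big1// => i _; rewrite covZl// covC cov_orthogonalize_score// mulr0.
Qed.

End orthogonalization.

(** * Mean and variance of an i.i.d. sample mean *)

Section sample_mean.
Context d d' (T : measurableType d) (T' : measurableType d') (R : realType).
Variables (P : probability T R) (Q : probability T' R).
Variables (S : nat) (theta : 'I_S -> {RV P >-> T'}).
Hypothesis S_gt0 : (0 < S)%N.
Hypothesis thetaQ : forall s A, measurable A -> distribution P (theta s) A = Q A.

Definition sample_mean (h : T' -> R) (w : T) : R :=
  S%:R^-1 * \sum_(s < S) h (theta s w).

Let thetaL2 h s : h \in Lfun Q 2%:E -> (h \o theta s) \in Lfun P 2%:E.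
Proof. by move=> h2; apply: (Lfun2_law (Q := Q)) => // A; exact: thetaQ. Qed.

Lemma Lfun2_sample_mean h : h \in Lfun Q 2%:E -> sample_mean h \in Lfun P 2%:E.
Proof.
by move=> h2; apply: Lfun2Z; apply: Lfun2_sum => s; exact: thetaL2.
Qed.

Lemma expectation_sample_mean h : h \in Lfun Q 2%:E ->
  ('E_P[sample_mean h] = 'E_Q[h])%E.
Proof.
move=> h2; have hs s := thetaL2 s h2.
rewrite expectationZ2; last exact: Lfun2_sum.
rewrite (expectation_sum2 _ hs).
under eq_bigr do rewrite (expectation_law (thetaQ _) h2).
rewrite -(fineK (expectation_fin_num (Lfun2_Lfun1 h2))) sumEFin sumr_const card_ord.
by rewrite -EFinM -[X in _ * X]mulr_natl mulKf// pnatr_eq0 -lt0n.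
Qed.

Hypothesis thetaI : mutually_independent P (fun s => theta s : T -> T').

Lemma pairwise_independent (s s' : 'I_S) A B : s != s' ->
  measurable A -> measurable B ->
  P (theta s @^-1` A `&` theta s' @^-1` B) = (Q A * Q B)%E.
Proof.
move=> ss' mA mB.
(* Mutual independence is tested on the index set [{s, s'}], so the values of [C] elsewhere do not
   matter. *)
pose C i := if i == s then A else B.
have Cs : C s = A by rewrite /C eqxx.
have Cs' : C s' = B by rewrite /C eq_sym (negPf ss').
have mC i : measurable (C i) by rewrite /C; case: ifP.
have /(_ (fun i _ => mC i)) := thetaI (J := [set s; s']%SET) (A := C).
rewrite big_setU1 ?inE//= big_set1 Cs Cs' -(thetaQ s mA) -(thetaQ s' mB) => <-.
congr (P _); apply/seteqP; split => w /=.
  by move=> [Aw Bw] i; rewrite /= !inE => /orP[]/eqP ->; rewrite ?Cs ?Cs'.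
move=> H; split; [move: (H s)|move: (H s')]; rewrite /= !inE eqxx ?orbT => /(_ isT).
  by rewrite Cs.
by rewrite Cs'.
Qed.

(** In the double sum of covariances the off-diagonal terms vanish by independence, and each of the
    [S] diagonal terms is the variance of [h]. *)
Lemma variance_sample_mean h : h \in Lfun Q 2%:E ->
  ('V_P[sample_mean h] = (S%:R^-1)%:E * 'V_Q[h])%E.
Proof.
move=> h2; have hs s := thetaL2 s h2.
have m2 := Lfun2_sample_mean h2.
have s2 : (fun w => \sum_(s < S) h (theta s w)) \in Lfun P 2%:E.
  exact: Lfun2_sum.
rewrite /variance -!EFin_cov// -EFinM; congr EFin.
rewrite {1}/sample_mean covZl// covC {1}/sample_mean covZl//.
rewrite (cov_suml _ hs)//.
under eq_bigr => s _.
  rewrite covC (cov_suml _ hs)// (bigD1 s)//= big1 => [|s' s's].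
    rewrite addr0 /cov -/(variance P _) (variance_law (thetaQ s) h2).
  over.
  apply: (cov_independent (thetaQ s') (thetaQ s)) => // A B mA mB.
  exact: (pairwise_independent s's mA mB).
(* Of the two factors [1/S], one cancels against the [S] equal terms. *)
rewrite sumr_const card_ord -[X in _ * (_ * X)]mulr_natl mulKf//.
by rewrite pnatr_eq0 -lt0n.
Qed.

End sample_mean.

(** * Cantelli's bound at zero and monotonicity of the ratio *)

Lemma cantelli_le0 d (T : measurableType d) (R : realType)
    (P : probability T R) (X : T -> R) (a : R) :
  X \in Lfun P 2%:E -> ('E_P[X] = a%:E)%E -> 0 < a ->
  (P [set w | (X w <= 0)%R] <= 'V_P[X] / ('V_P[X] + (a ^+ 2)%R%:E))%E.
Proof.
move=> X2 EX a0.
have mX : measurable_fun [set: T] (\- X).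
  by apply: measurableT_comp => //; exact: Lfun2_measurable X2.
pose mXmfun := isMeasurableFun.Build _ _ _ _ (\- X) mX.
(* Cantelli is applied to [-X], of mean [-a], with deviation [a]: the event that [-X + a] is at
   least [a] is [X <= 0]. *)
pose Y : {RV P >-> R} := HB.pack (\- X) mXmfun.
have Y2 : (Y : T -> R) \in Lfun P 2%:E by rewrite rpredN.
have EY : ('E_P[Y] = - a%:E)%E.
  rewrite -EX -mulN1e -(expectationZ2 (-1) X2).
  by congr expectation; apply/funext => w /=; rewrite mulN1r.
have VY : ('V_P[Y] = 'V_P[X])%E := varianceN X2.
have := cantelli Y2 a0; rewrite VY EY.
have fV := variance_fin_num X2.
have V0 : 0 <= fine 'V_P[X]%E by rewrite fine_ge0// variance_ge0.
(* Since [a] is positive the denominator is nonzero even if the variance vanishes, so the extended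
   inverse is the real one. *)
rewrite -[in X in _ -> X](fineK fV) -EFinD inver gt_eqF; last first.
  by rewrite ltr_wpDl// exprn_gt0.
move=> H; rewrite -EFinM; apply: le_trans H.
rewrite le_eqVlt; apply/orP; left; apply/eqP; congr (P _).
apply/seteqP; split => w /=; rewrite lee_fin opprK.
  by move=> Xw; rewrite lerDr oppr_ge0.
by rewrite lerDr oppr_ge0.
Qed.

(** Clearing denominators, the terms [x * y] cancel and [x * c <= y * c] remains. *)
Lemma le_ratio_ereal (R : realType) (x y : \bar R) (c : R) :
  x \is a fin_num -> y \is a fin_num -> (0 <= x)%E -> (x <= y)%E -> 0 < c ->
  (x / (x + c%:E) <= y / (y + c%:E))%E.
Proof.
case: x y => [x||] [y||]// _ _; rewrite !lee_fin => x0 xy c0.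
have y0 := le_trans x0 xy.
rewrite -!EFinD !inver !gt_eqF ?ltr_wpDl// -!EFinM lee_fin.
rewrite ler_pdivrMr ?ltr_wpDl// mulrAC ler_pdivlMr ?ltr_wpDl//.
by rewrite !mulrDr [y * x]mulrC lerD2l ler_pM2r.
Qed.

(** * Unbiasedness and comparison of the misranking bounds *)

Theorem proposition4p3 (R : realType) (d n : nat)
    (Lambda : set 'rV[R]_d)
    (t : nat) (D : t.-tuple ('rV[R]_d * R))
    (m : surrogate R d n)
    (q : 'rV[R]_n -> R) (Q : probability 'rV[R]_n R)
    (l l' : 'rV[R]_d)
    (disp : measure_display) (Omega : measurableType disp)
    (P : probability Omega R)
    (S : nat) (theta : 'I_S -> {RV P >-> 'rV[R]_n}) :
  let Theta := params m in
  let g := score Theta q in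
  let ei := EI D m in
  let ei_orth := fun x => orthogonalize Q g (ei x) in
  let Delta := fine 'E_Q[ei l]%E - fine 'E_Q[ei l']%E in
  let Delta_MC := sample_diff theta (ei l) (ei l') in
  let Delta_orth := sample_diff theta (ei_orth l) (ei_orth l') in
  (0 < t)%N ->
  (forall x, Lambda x -> forall th, Theta th -> (EIe D m x th < +oo)%E) ->
  (forall x, Lambda x -> measurable_fun Theta (ei x)) ->
  Lambda l -> Lambda l' ->
  pos_prob_density Theta q ->
  has_density Theta q Q ->
  (forall th, Theta th -> differentiable q th) ->
  (forall j, (lebesgue_rV R n).-integrable Theta
               (fun th => (grad q th j ord0)%:E)) ->
  (forall j, (\int[lebesgue_rV R n]_(th in Theta) (grad q th j ord0)%:E = 0)%E) ->
  ('E_Q[fun th => (ei l th ^+ 2)%R] < +oo)%E ->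
  ('E_Q[fun th => (ei l' th ^+ 2)%R] < +oo)%E ->
  ('E_Q[fun th => (norm2 (g th) ^+ 2)%R] < +oo)%E ->
  cov_mx Q g \in unitmx ->
  0 < Delta ->
  (0 < S)%N ->
  (forall s A, measurable A -> distribution P (theta s) A = Q A) ->
  mutually_independent P (fun s => theta s : Omega -> 'rV[R]_n) ->
  [/\ ('E_P[Delta_MC] = Delta%:E)%E,
      ('E_P[Delta_orth] = Delta%:E)%E,
      (P [set w | (Delta_orth w <= 0)%R]
        <= 'V_P[Delta_orth] / ('V_P[Delta_orth] + (Delta ^+ 2)%R%:E))%E
    & ('V_P[Delta_orth] / ('V_P[Delta_orth] + (Delta ^+ 2)%R%:E)
        <= 'V_P[Delta_MC] / ('V_P[Delta_MC] + (Delta ^+ 2)%R%:E))%E].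
Proof.
move=> Theta g ei ei_orth Delta Delta_MC Delta_orth _ _ mei Ll Ll' qTheta Qq dq
  intgrad grad0 El El' Eg Su Delta_gt0 S_gt0 thetaQ thetaI.
have ei2 x : Lambda x -> ('E_Q[fun th => (ei x th ^+ 2)%R] < +oo)%E ->
    ei x \in Lfun Q 2%:E.
  move=> Lx; apply: Lfun2_expectation_sqr.
  have [mTheta _ _ _] := qTheta.
  (* Measurability is assumed on [Theta] only; the zero convention outside extends it to the whole
     space. *)
  rewrite (_ : ei x = ei x \_ Theta); last first.
    by apply/funext => th; rewrite [RHS]patchE /ei /EI patchE; case: ifPn.
  by apply/(measurable_restrictT _ mTheta); exact: mei.
have eil := ei2 _ Ll El; have eil' := ei2 _ Ll' El'.
have g2 j : (fun x => g x j ord0) \in Lfun Q 2%:E by exact: Lfun2_score.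
have Eg0 j : ('E_Q[fun x => g x j ord0] = 0)%E.
  by apply: expectation_score => //; exact: g2.
pose h x := ei l x - ei l' x.
have h2 : h \in Lfun Q 2%:E by exact: Lfun2B.
have o2 : orthogonalize Q g h \in Lfun Q 2%:E by exact: Lfun2_orthogonalize.
(* By linearity, both estimators are sample means of one function: [h], or its residual. *)
have Delta_orthE : Delta_orth = sample_mean theta (orthogonalize Q g h).
  by rewrite orthogonalizeB.
have Delta_MCE : Delta_MC = sample_mean theta h by [].
have Eh : 'E_Q[h]%E = Delta%:E.
  rewrite (expectationB (Lfun2_Lfun1 eil) (Lfun2_Lfun1 eil')).
  by rewrite EFinB !fineK// expectation_fin_num// Lfun2_Lfun1.
have Eorth : 'E_P[Delta_orth]%E = Delta%:E.
  rewrite Delta_orthE (expectation_sample_mean S_gt0 thetaQ o2).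
  by rewrite expectation_orthogonalize.
have MC2 : Delta_MC \in Lfun P 2%:E by exact: Lfun2_sample_mean h2.
have orth2 : Delta_orth \in Lfun P 2%:E.
  by rewrite Delta_orthE; exact: Lfun2_sample_mean o2.
split => //.
- by rewrite Delta_MCE (expectation_sample_mean S_gt0 thetaQ h2).
- exact: cantelli_le0.
- apply: le_ratio_ereal; rewrite ?variance_fin_num ?variance_ge0 ?exprn_gt0//.
  (* Both variances carry the same factor [1/S], so it suffices to compare them for a single
     draw. *)
  rewrite Delta_orthE Delta_MCE.
  rewrite (variance_sample_mean S_gt0 thetaQ thetaI o2).
  rewrite (variance_sample_mean S_gt0 thetaQ thetaI h2).
  apply: lee_wpmul2l; first by rewrite lee_fin invr_ge0.
  exact: variance_orthogonalize_le.
Qed.
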